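(* Let $(A_n)_{n\ge1}$ be the first of the four sequences $A,B,C,D$ associated with the anti-Tribonacci sequence $(D_n)$. Then for all $n\ge 1$, $$A_{n+4}+A_n=A_{n+3}+A_{n+1}.$$
   Context: For a set $S$ of positive integers, $\mathrm{mex}(S)$ denotes the smallest positive integer not in $S$. The sequences are defined recursively as follows: $A_1=1$, $B_1=2$, $C_1=3$, $D_1=6$, and for $n\ge 1$, with $S_n=\{A_i,B_i,C_i,D_i: 1\le i\le n\}$, one sets $A_{n+1}=\mathrm{mex}(S_n)$, $B_{n+1}=\mathrm{mex}(S_n\cup\{A_{n+1}\})$, $C_{n+1}=\mathrm{mex}(S_n\cup\{A_{n+1},B_{n+1}\})$, and $D_{n+1}=A_{n+1}+B_{n+1}+C_{n+1}$. The $D_n$ are the anti-Tribonacci numbers $6,16,27,36,46,57,66,75,87,96,\ldots$ (OEIS A265389). *)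

(* Defs.v *)
From mathcomp Require Import all_boot.

Set Implicit Arguments.
Unset Strict Implicit.
Unset Printing Implicit Defensive.

Lemma ex_mex (s : seq nat) : exists k, (0 < k) && (k \notin s).
Proof.
exists (foldr maxn 0 s).+1 => /=; apply/negP => in_s.
suff /(_ _ in_s) : forall k, k \in s -> k <= foldr maxn 0 s by rewrite ltnn.
elim: {in_s} s => //= x s IHs k; rewrite inE leq_max => /orP[/eqP -> | /IHs ->].
  by rewrite leqnn.
by rewrite orbT.
Qed.

(* Finite sets of positive integers are represented by sequences, of which    *)
(* only the membership matters; mex s is the least positive integer not in s. *)
Definition mex (s : seq nat) : nat := ex_minn (ex_mex s).

Record row := Row { rowA : nat; rowB : nat; rowC : nat; rowD : nat }.

Definition row_elems (r : row) : seq nat :=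
  [:: rowA r; rowB r; rowC r; rowD r].

Definition next_row (s : seq nat) : row :=
  let a := mex s in
  let b := mex (a :: s) in
  let c := mex [:: a, b & s] in
  Row a b c (a + b + c).

(* state m is the pair of (A_n, B_n, C_n, D_n) and S_n for n = m + 1. *)
Fixpoint state (m : nat) : row * seq nat :=
  if m is m'.+1 then
    let s := (state m').2 in
    let r := next_row s in
    (r, s ++ row_elems r)
  else let r := Row 1 2 3 6 in (r, row_elems r).

(* The sequences are indexed from 1; their values at 0 are irrelevant. *)
Definition antiA (n : nat) : nat := rowA (state n.-1).1.
Definition antiB (n : nat) : nat := rowB (state n.-1).1.
Definition antiC (n : nat) : nat := rowC (state n.-1).1.
Definition antiD (n : nat) : nat := rowD (state n.-1).1.

Definition antiS (n : nat) : seq nat :=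
  flatten [seq [:: antiA i; antiB i; antiC i; antiD i] | i <- iota 1 n].

Lemma antiSE (m : nat) : (state m).2 = antiS m.+1.
Proof.
elim: m => [//|m IHm].
rewrite {1}/antiS -[m.+2]addn1 iotaD map_cat flatten_cat -/(antiS m.+1) -IHm.
by rewrite add1n.
Qed.

Lemma anti1 : [/\ antiA 1 = 1, antiB 1 = 2, antiC 1 = 3 & antiD 1 = 6].
Proof. by []. Qed.

Lemma antiS_rec (n : nat) : 0 < n ->
  [/\ antiA n.+1 = mex (antiS n),
      antiB n.+1 = mex (antiA n.+1 :: antiS n),
      antiC n.+1 = mex [:: antiA n.+1, antiB n.+1 & antiS n]
    & antiD n.+1 = antiA n.+1 + antiB n.+1 + antiC n.+1].
Proof.
by case: n => // n _; rewrite /antiA /antiB /antiC /antiD /= antiSE.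
Qed.

(* Main.v *)
(* The integers split into blocks 10k+1, ..., 10k+10, and D_{k+1} lies in the *)
(* k-th one, at 10k+5, 10k+6 or 10k+7. Hence the rows 3j+1, 3j+2 and 3j+3     *)
(* fill the block j: they are {1,2,3}, {4,5,6,7} minus D_{j+1}, and {8,9,10}, *)
(* up to the shift by 10j. Their sums are 30j+6, 30j + {15,16,17} and 30j+27, *)
(* which places the next values of D as claimed, and A_{n+3} = A_n + 10.      *)
Require Import Defs.
From mathcomp Require Import all_boot zify.

Set Implicit Arguments.
Unset Strict Implicit.
Unset Printing Implicit Defensive.

(** The proof is an induction on blocks of ten. After each row, [antiS n] is an initial segment
    together with the earlier values of [antiD] ([covers]), so the next row takes the three smallest
    integers past the segment that are not such values ([row_step]). Three rows exhaust a block and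
    put their own sums in the prescribed windows ([block_step]), which gives the shift [antiA_add3].
    Used at [n] and [n + 1], it makes both sides equal to [antiA n + antiA (n + 1) + 10]. *)

Lemma mex_eq (s : seq nat) (v : nat) : 0 < v -> v \notin s ->
  (forall u, 0 < u < v -> u \in s) -> mex s = v.
Proof.
move=> v_gt0 vNs s_lt_v; rewrite /mex; case: ex_minnP => m /andP[m_gt0 mNs] m_min.
apply/eqP; rewrite eqn_leq m_min ?v_gt0 //= leqNgt.
by apply: contra mNs => m_lt_v; apply: s_lt_v; rewrite m_gt0.
Qed.

(** Since 1 + 2 + 3 = 6, the prescribed first row is what the recursion yields from the empty set,
    so the block induction can start from nothing. *)
Lemma antiS_rec0 (n : nat) :
  [/\ antiA n.+1 = mex (antiS n),
      antiB n.+1 = mex (antiA n.+1 :: antiS n),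
      antiC n.+1 = mex [:: antiA n.+1, antiB n.+1 & antiS n]
    & antiD n.+1 = antiA n.+1 + antiB n.+1 + antiC n.+1].
Proof.
case: n => [|n]; last exact: antiS_rec.
have [-> -> -> ->] := anti1.
by split=> //; apply/esym/mex_eq => // -[|[|[|u]]].
Qed.

Lemma antiSS (n : nat) :
  antiS n.+1 = antiS n ++ [:: antiA n.+1; antiB n.+1; antiC n.+1; antiD n.+1].
Proof. by rewrite /antiS -[X in iota 1 X]addn1 iotaD map_cat flatten_cat /= add1n. Qed.

Definition inD (n x : nat) : Prop := exists2 k, k < n & x = antiD k.+1.

(** The alternatives may overlap, so values of [antiD] need not be tracked once the segment has
    passed them. *)
Definition covers (n t : nat) : Prop :=
  forall x, x \in antiS n <-> 0 < x <= t \/ inD n x.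

Definition D_in_blocks (n : nat) : Prop :=
  forall k, k < n -> 10 * k + 5 <= antiD k.+1 <= 10 * k + 7.

Lemma inDS (n x : nat) : inD n.+1 x <-> inD n x \/ x = antiD n.+1.
Proof.
split=> [[k k_lt ->] | [[k k_lt ->] | ->]].
- by move: k_lt; rewrite ltnS leq_eqVlt => /orP[/eqP-> | ?]; [right | left; exists k].
- by exists k => //; apply: ltnW.
- by exists n.
Qed.

(** This keeps the first and third rows of a block clear of [antiD]. *)
Lemma inD_mod (n x : nat) : D_in_blocks n -> inD n x -> 5 <= x %% 10 <= 7.
Proof. by move=> Dn [k /Dn Dk ->]; lia. Qed.

Lemma inD_block (n j x : nat) : D_in_blocks n ->
  inD n x -> 10 * j <= x < 10 * j + 10 -> x = antiD j.+1.
Proof. by move=> Dn [k /Dn Dk ->] x_j; congr (antiD _.+1); lia. Qed.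

(** Whatever lies in [(t, t']] besides [a], [b], [c] is already taken, so the successive mex values
    stop exactly there. *)
Lemma row_step (n t t' a b c : nat) : covers n t ->
    [/\ t < a, a < b, b < c & c <= t'] ->
    ~ inD n a -> ~ inD n b -> ~ inD n c ->
    (forall u, t < u <= t' -> [\/ u = a, u = b, u = c | inD n u]) ->
  [/\ antiA n.+1 = a, antiD n.+1 = a + b + c & covers n.+1 t'].
Proof.
move=> cov [lt_ta lt_ab lt_bc le_ct'] aND bND cND fill.
have notS x : t < x -> ~ inD n x -> x \notin antiS n.
  by move=> lt_tx xND; apply/negP => /cov[|//]; lia.
have inS u : 0 < u <= t' -> [|| u == a, u == b, u == c | u \in antiS n].
  move=> u_le; have [le_ut | lt_tu] := leqP u t.
    have -> : u \in antiS n by apply/cov; left; lia.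
    by rewrite !orbT.
  have [|->|->|->|uD] := fill u; rewrite ?eqxx ?orbT //; first by lia.
  have -> : u \in antiS n by apply/cov; right.
  by rewrite !orbT.
have [eqA eqB eqC eqD] := antiS_rec0 n.
have Ea : antiA n.+1 = a.
  rewrite eqA; apply: mex_eq; [by lia | by apply: notS |] => u u_lt.
  by have := inS u; case: (u \in _) => //; lia.
have Eb : antiB n.+1 = b.
  rewrite eqB Ea; apply: mex_eq; first by lia.
    by rewrite inE negb_or notS //; lia.
  by move=> u u_lt; rewrite inE; have := inS u; case: (u \in _); lia.
have Ec : antiC n.+1 = c.
  rewrite eqC Ea Eb; apply: mex_eq; first by lia.
    by rewrite !inE !negb_or notS //; lia.
  by move=> u u_lt; rewrite !inE; have := inS u; case: (u \in _); lia.
split=> //; first by rewrite eqD Ea Eb Ec.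
move=> x; rewrite antiSS mem_cat !inE Ea Eb Ec; split.
  case/orP=> [/cov[x_le | xD] | /or4P[] /eqP->].
  - by left; lia.
  - by right; apply/inDS; left.
  - by left; lia.
  - by left; lia.
  - by left; lia.
  - by right; apply/inDS; right.
case=> [/inS/or4P[]-> | /inDS[xD | ->]]; rewrite ?eqxx ?orbT //.
by apply/orP; left; apply/cov; right.
Qed.

Lemma D_in_blocksS (n : nat) : D_in_blocks n ->
  10 * n + 5 <= antiD n.+1 <= 10 * n + 7 -> D_in_blocks n.+1.
Proof. by move=> Dn Dn1 k; rewrite ltnS leq_eqVlt => /orP[/eqP-> | /Dn]. Qed.

Lemma block_step (j : nat) : covers (3 * j) (10 * j) -> D_in_blocks (3 * j) ->
  [/\ antiA (3 * j).+1 = 10 * j + 1, antiA (3 * j).+2 = 10 * j + 4,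
      antiA (3 * j).+3 = 10 * j + 8, covers (3 * j).+3 (10 * j + 10)
    & D_in_blocks (3 * j).+3].
Proof.
move=> cov0 Db0.
have [||||u u_le|A1 D1 cov1] :=
    @row_step _ _ (10 * j + 3) (10 * j + 1) (10 * j + 2) (10 * j + 3) cov0.
- by split; lia.
- by move/(inD_mod Db0); lia.
- by move/(inD_mod Db0); lia.
- by move/(inD_mod Db0); lia.
- have /or3P[] : [|| u == 10 * j + 1, u == 10 * j + 2 | u == 10 * j + 3] by lia.
  + by move/eqP=> ?; constructor 1.
  + by move/eqP=> ?; constructor 2.
  + by move/eqP=> ?; constructor 3.
have Db1 : D_in_blocks (3 * j).+1 by apply: D_in_blocksS => //; lia.
(* The second row must avoid [antiD j.+1], which is already known; for [j = 0] it has only just been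
   produced by the first row. *)
have lt_j : j < (3 * j).+1 by lia.
have inDj : inD (3 * j).+1 (antiD j.+1) by exists j.
have notD2 x : 10 * j <= x < 10 * j + 10 -> x <> antiD j.+1 -> ~ inD (3 * j).+1 x.
  by move=> x_j x_neq xD; apply: x_neq; apply: inD_block xD x_j.
have Dj := Db1 _ lt_j.
set d := antiD j.+1 in Dj inDj notD2.
(* [b] and [c] are the two of 10j+5, 10j+6, 10j+7 that differ from [d]; the three add up to
   30j+18. *)
have [b [c [lt_b lt_bc le_c [b_neq c_neq sum_bcd]]]] : exists b c,
    [/\ 10 * j + 4 < b, b < c, c <= 10 * j + 7
      & [/\ b <> d, c <> d & b + c + d = 30 * j + 18]].
  have /or3P[] : [|| d == 10 * j + 5, d == 10 * j + 6 | d == 10 * j + 7] by lia.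
  + by move/eqP->; exists (10 * j + 6), (10 * j + 7); do !split; lia.
  + by move/eqP->; exists (10 * j + 5), (10 * j + 7); do !split; lia.
  + by move/eqP->; exists (10 * j + 5), (10 * j + 6); do !split; lia.
have [||||u u_le|A2 D2 cov2] := @row_step _ _ (10 * j + 7) (10 * j + 4) b c cov1.
- by split; lia.
- by apply: notD2; lia.
- by apply: notD2; lia.
- by apply: notD2; lia.
- have /or4P[] : [|| u == 10 * j + 4, u == b, u == c | u == d] by lia.
  + by move/eqP=> ?; constructor 1.
  + by move/eqP=> ?; constructor 2.
  + by move/eqP=> ?; constructor 3.
  + by move/eqP->; constructor 4.
(* The row sum is 40j+22-d, which lies between 30j+15 and 30j+17. *)
have Db2 : D_in_blocks (3 * j).+2.
  by apply: D_in_blocksS => //; lia.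
have [||||u u_le|A3 D3 cov3] :=
    @row_step _ _ (10 * j + 10) (10 * j + 8) (10 * j + 9) (10 * j + 10) cov2.
- by split; lia.
- by move/(inD_mod Db2); lia.
- by move/(inD_mod Db2); lia.
- by move/(inD_mod Db2); lia.
- have /or3P[] : [|| u == 10 * j + 8, u == 10 * j + 9 | u == 10 * j + 10] by lia.
  + by move/eqP=> ?; constructor 1.
  + by move/eqP=> ?; constructor 2.
  + by move/eqP=> ?; constructor 3.
by split=> //; apply: D_in_blocksS => //; lia.
Qed.

Lemma block_invariant (j : nat) :
  covers (3 * j) (10 * j) /\ D_in_blocks (3 * j).
Proof.
elim: j => [|j [cov Db]].
  by split=> // x; split=> // -[|[]//]; lia.
have [_ _ _ cov' Db'] := block_step cov Db.
have -> : 3 * j.+1 = (3 * j).+3 by lia.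
by have -> : 10 * j.+1 = 10 * j + 10 by lia.
Qed.

Lemma antiA_block (j : nat) :
  [/\ antiA (3 * j).+1 = 10 * j + 1, antiA (3 * j).+2 = 10 * j + 4
    & antiA (3 * j).+3 = 10 * j + 8].
Proof. by have [cov Db] := block_invariant j; have [] := block_step cov Db. Qed.

Lemma antiA_add3 (n : nat) : 0 < n -> antiA (n + 3) = antiA n + 10.
Proof.
move=> n_gt0; pose j := n.-1 %/ 3.
have [A1 A2 A3] := antiA_block j; have [A4 A5 A6] := antiA_block j.+1.
have eq3 : 3 * j.+1 = 3 * j + 3 by lia.
rewrite eq3 -!addSn in A4 A5 A6.
have /or3P[] : [|| n == (3 * j).+1, n == (3 * j).+2 | n == (3 * j).+3].
  by rewrite /j; lia.
- by move/eqP->; rewrite A4 A1; lia.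
- by move/eqP->; rewrite A5 A2; lia.
- by move/eqP->; rewrite A6 A3; lia.
Qed.

Theorem mainTheorem5 (n : nat) (hn : 1 <= n) :
  antiA (n + 4) + antiA n = antiA (n + 3) + antiA (n + 1).
Proof.
have -> : n + 4 = n + 1 + 3 by rewrite -addnA.
by rewrite !antiA_add3 ?addn1 //; lia.
Qed.
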